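(* Let $K$ be a totally real number field, Galois over $\mathbb{Q}$, with ring of integers $\mathcal{O}_K$ and different $\mathcal{D}_K$ over $\mathbb{Q}$, and let $\ell$ be a square-free positive integer. There exists an Arakelov-modular lattice of level $\ell$ over $K$ if and only if there exist a totally positive $\alpha\in K^\times$ and $\beta\in K^\times$ such that $\ell=\beta^2$ and $v_{\mathfrak{P}}(\alpha^{-1}\beta\mathcal{D}_K^{-1})$ is even for every prime ideal $\mathfrak{P}$ of $\mathcal{O}_K$.
   Context: An element $\alpha\in K^\times$ is totally positive if $\sigma(\alpha)>0$ for every embedding $\sigma:K\to\mathbb{R}$. The inverse different is $\mathcal{D}_K^{-1}=\{x\in K:\mathrm{Tr}_{K/\mathbb{Q}}(xy)\in\mathbb{Z}\ \forall y\in\mathcal{O}_K\}$. For a fractional ideal $\mathfrak{a}$ and a prime ideal $\mathfrak{P}$ of $\mathcal{O}_K$, $v_{\mathfrak{P}}(\mathfrak{a})$ is the exponent of $\mathfrak{P}$ in the factorization of $\mathfrak{a}$. An ideal lattice over the totally real field $K$ is a pair $(I,\alpha)$, where $I$ is a (nonzero) fractional $\mathcal{O}_K$-ideal, $\alpha\in K^\times$ is totally positive, and $I$ carries the positive definite symmetric bilinear form $b_\alpha(x,y)=\mathrm{Tr}_{K/\mathbb{Q}}(\alpha xy)$. Its dual is $(I^*,\alpha)$ with $I^*=\alpha^{-1}\mathcal{D}_K^{-1}I^{-1}=\{x\in K: b_\alpha(x,y)\in\mathbb{Z}\ \forall y\in I\}$. For a positive integer $\ell$, $(I,\alpha)$ is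 Arakelov-modular of level $\ell$ if there exists $\beta\in K^\times$ such that $I=\beta I^*$ and $\ell=\beta^2$. *)

(* Defs.v *)
From mathcomp Require Import all_boot all_order all_algebra all_field.
From mathcomp Require Import boolp classical_sets.

Set Implicit Arguments.
Unset Strict Implicit.
Unset Printing Implicit Defensive.

Import GRing.Theory Num.Theory.

Local Open Scope classical_set_scope.
Local Open Scope ring_scope.

Definition squarefree (n : nat) : Prop :=
  forall d : nat, (d * d %| n)%N -> d = 1%N.

Section NumberField.

Variable K : splittingFieldType rat.

(* The image of an embedding of K into the complex numbers consists of
   algebraic numbers, so embeddings into algC are all the complex embeddings;
   the embeddings of K into the reals are those with real values. *)
Definition real_embedding (sigma : {rmorphism K -> algC}) : Prop :=
  forall x : K, sigma x \is Num.real.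

Definition totally_real : Prop :=
  forall sigma : {rmorphism K -> algC}, real_embedding sigma.

Definition totally_positive (alpha : K) : Prop :=
  forall sigma : {rmorphism K -> algC},
    real_embedding sigma -> 0 < sigma alpha.

Definition ring_of_integers : set K :=
  [set x | integralOver (intr : int -> K) x].

Local Notation OK := ring_of_integers.

(* When K is Galois over Q, this is Tr_{K/Q}; its values lie in the copy of Q
   inside K. *)
Definition trace (x : K) : K := galTrace 1%VS {:K} x.

Definition rational_integer (x : K) : Prop := exists m : int, x = m%:~R.

Definition inverse_different : set K :=
  [set x | forall y, OK y -> rational_integer (trace (x * y))].

(* Nonzero fractional ideals; closure under opposites follows from stability
   under multiplication by -1. *)
Definition fractional_ideal (I : set K) : Prop :=
  [/\ I 0 /\ (forall x y, I x -> I y -> I (x + y)),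
      forall a x, OK a -> I x -> I (a * x),
      exists2 x, I x & x != 0 &
      exists d, [/\ OK d, d != 0 & forall x, I x -> OK (d * x)]].

(* Nonzero prime ideals. *)
Definition prime_ideal (P : set K) : Prop :=
  [/\ fractional_ideal P, P `<=` OK, ~ P 1 &
      forall x y, OK x -> OK y -> P (x * y) -> P x \/ P y].

Definition ideal_scale (c : K) (I : set K) : set K := [set c * x | x in I].

Definition ideal_mul (I J : set K) : set K :=
  [set z | exists s : seq (K * K),
     (forall p, p \in s -> I p.1 /\ J p.2) /\ z = \sum_(p <- s) p.1 * p.2].

Definition ideal_inv (I : set K) : set K :=
  [set x | forall y, I y -> OK (x * y)].

Definition ideal_exp (I : set K) (n : int) : set K :=
  match n with
  | Posz k => iter k (ideal_mul I) OK
  | Negz k => iter k.+1 (ideal_mul (ideal_inv I)) OK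
  end.

(* [e] is a family of exponents with finite support contained in the set of
   prime ideals, and [I] is the product of the [P ^ e P]. *)
Definition ideal_factorization (I : set K) (e : set K -> int) : Prop :=
  exists s : seq (set K),
    [/\ uniq s,
        forall P, P \in s -> prime_ideal P,
        forall P, P \notin s -> e P = 0 &
        I = \big[ideal_mul/OK]_(P <- s) ideal_exp P (e P)].

(* Meaningful for a (nonzero) fractional ideal I, for which the family of
   exponents exists and is unique; the default 0 is then irrelevant. *)
Definition valuation (P I : set K) : int :=
  xget (fun=> 0) [set e | ideal_factorization I e] P.

Definition trace_form (alpha x y : K) : K := trace (alpha * x * y).

Definition ideal_lattice (I : set K) (alpha : K) : Prop :=
  [/\ fractional_ideal I, alpha != 0 & totally_positive alpha].

Definition dual_lattice (I : set K) (alpha : K) : set K :=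
  [set x | forall y, I y -> rational_integer (trace_form alpha x y)].

Definition arakelov_modular (l : nat) (I : set K) (alpha : K) : Prop :=
  exists beta : K,
    [/\ beta != 0, I = ideal_scale beta (dual_lattice I alpha)
      & l%:R = beta ^+ 2].

End NumberField.

Arguments ring_of_integers K : clear implicits.
Arguments inverse_different K : clear implicits.

(* Main.v *)
Require Import Defs.
From HB Require Import structures.
From mathcomp Require Import all_boot all_order all_fingroup all_algebra all_field.
From mathcomp Require Import boolp classical_sets.

Set Implicit Arguments.
Unset Strict Implicit.
Unset Printing Implicit Defensive.

Import Order.TTheory GRing.Theory Num.Theory.

Local Open Scope classical_set_scope.
Local Open Scope ring_scope.

(** For a fractional ideal [I] with inverse [I^-1], the dual of [(I, alpha)] is
    [alpha^-1 D^-1 I^-1], where [D^-1] is the inverse different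
    ([dual_latticeE]). Hence [I] is [beta] times its dual if and only if
    [I^2 = alpha^-1 beta D^-1] ([scaled_dual_eq_iff]), and the theorem says that a
    fractional ideal is a square if and only if all its valuations are even
    ([even_valuationP]): given a factorization with even exponents, the square
    root is obtained by halving them.

    This rests on the fact that the fractional ideals of the ring of integers form
    a group, freely generated by the prime ideals. The proof draws on one
    finiteness property: the residue ring modulo a nonzero integer of K is finite
    ([finite_residues]), since an element of K is recovered from finitely many of
    its traces ([trace_coordinates]).
    - Ideals containing a given nonzero element are finitely many, whence Noetherian
      induction ([integral_ideal_ind]).
    - Among the powers of an element two are congruent modulo a given nonzero
      one. Hence nonzero primes are maximal ([prime_ideal_inverse]), and [x] is
      integral as soon as all the [c x ^+ n] are, for some [c != 0]
      ([almost_integral]).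
    - The inverse of a prime [P] contains a non-integral [x]
      ([prime_ideal_inv_nonintegral]). If [I I^-1] were contained in [P], then [x]
      would stabilize [I^-1] and so be integral; thus [I] is invertible
      ([ideal_mul_inv]).

    Existence of factorizations follows by Noetherian induction, and
    uniqueness from the fact that no positive power of [P] is a quotient of two
    integral ideals not contained in [P] ([prime_not_unit_at]). *)

(** * Algebraic integers of K *)

Section Integers.

Variable K : splittingFieldType rat.
Local Notation OK := (ring_of_integers K).
Implicit Types (x y : K) (s : gal_of {:K}).

Lemma OK0 : OK 0. Proof. exact: integral0. Qed.
Lemma OK1 : OK 1. Proof. exact: integral1. Qed.
Lemma OKD x y : OK x -> OK y -> OK (x + y). Proof. exact: integral_add. Qed.
Lemma OKN x : OK x -> OK (- x). Proof. exact: integral_opp. Qed.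
Lemma OKB x y : OK x -> OK y -> OK (x - y). Proof. exact: integral_sub. Qed.
Lemma OKM x y : OK x -> OK y -> OK (x * y). Proof. exact: integral_mul. Qed.
Lemma OK_int (m : int) : OK m%:~R. Proof. exact: integral_id. Qed.
Lemma OK_nat (m : nat) : OK m%:R. Proof. exact: integral_nat. Qed.

Lemma intrK_eq0 (m : int) : (m%:~R == 0 :> K) = (m == 0).
Proof. by rewrite -(rmorph_int (in_alg K)) fmorph_eq0 intr_eq0. Qed.

Lemma OKX x n : OK x -> OK (x ^+ n).
Proof.
by move=> Ox; elim: n => [|n IHn]; [exact: OK1 | rewrite exprS; apply: OKM].
Qed.

Lemma OK_sum (I : Type) (r : seq I) (P : pred I) (F : I -> K) :
  (forall i, P i -> OK (F i)) -> OK (\sum_(i <- r | P i) F i).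
Proof. by move=> OF; elim/big_ind: _; [exact: OK0 | exact: OKD |]. Qed.

Lemma OK_prod (I : Type) (r : seq I) (P : pred I) (F : I -> K) :
  (forall i, P i -> OK (F i)) -> OK (\prod_(i <- r | P i) F i).
Proof. by move=> OF; elim/big_ind: _; [exact: OK1 | exact: OKM |]. Qed.

Lemma OK_monic_root (p : {poly K}) x :
  p \is monic -> root p x -> (forall i, OK p`_i) -> OK x.
Proof.
by move=> p_monic px0 Op; apply: integral_root_monic p_monic px0 _; apply/integral_poly.
Qed.

Lemma OK_gal s x : OK x -> OK (s x).
Proof.
move=> /(integral_rmorph s)[p p_monic px0]; exists p => //.
by rewrite -(eq_map_poly (f := s \o intr)) // => m /=; rewrite rmorph_int.
Qed.

(** An algebraic number [x] is a root of a monic rational polynomial [p]; if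
    [a] is a common denominator of its coefficients, then [a x] is a root of
    the monic polynomial with coefficients [a ^ (n - i) p_i], [n] being the
    degree of [p]. *)
Lemma OK_denominator x : exists2 a : int, a != 0 & OK (a%:~R * x).
Proof.
have /polyOver1P[p Dp] := minPolyOver 1 x.
have [q [a nz_a Dq]] := rat_poly_scale p.
have p_coef i : a%:~R * (minPoly 1 x)`_i = (q`_i)%:~R.
  rewrite Dp Dq coef_map /= coefZ coef_map /=.
  rewrite -(rmorph_int (in_alg K)) -rmorphM /= mulrA divff ?intr_eq0 // mul1r.
  exact: (rmorph_int (in_alg K)).
set n := adjoin_degree 1 x; have size_p : size (minPoly 1 x) = n.+1.
  by rewrite size_minPoly.
have lead_p : (minPoly 1 x)`_n = 1.
  by have /monicP := monic_minPoly 1 x; rewrite lead_coefE size_p.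
exists a => //; pose r := \poly_(i < n.+1) (a%:~R ^+ (n - i) * (minPoly 1 x)`_i).
have r_monic : r \is monic.
  rewrite monicE lead_coefE (size_poly_eq _) ?coef_poly ?ltnSn /= subnn lead_p.
    by rewrite mul1r.
  by rewrite mul1r oner_eq0.
apply: (OK_monic_root r_monic) => [|i]; last first.
  rewrite coef_poly; case: ltnP => [lt_in|_]; last exact: OK0.
  move: lt_in; rewrite ltnS leq_eqVlt => /predU1P[->|lt_in].
    by rewrite subnn lead_p mul1r; apply: OK1.
  rewrite -(prednK (n := n - i)) ?subn_gt0 // exprSr -mulrA p_coef.
  by rewrite -rmorphXn -rmorphM; apply: OK_int.
have: root (minPoly 1 x) x := root_minPoly 1 x.
rewrite !rootE horner_coef size_p horner_poly => /eqP px0.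
have := mulr0 (a%:~R ^+ n : K); rewrite -[in LHS]px0 mulr_sumr => rax0.
apply/eqP; rewrite -[RHS]rax0.
apply: eq_bigr => i _; rewrite exprMn mulrACA -exprD subnK ?mulrA //.
by rewrite -ltnS.
Qed.

(** The field of rational numbers is mapped to the algebraic complex numbers,
    where rational algebraic integers are known to be integers. *)
Lemma rational_OK x : x \in 1%VS -> OK x -> rational_integer x.
Proof.
move=> /vlineP[q ->] [p p_monic pq0].
suff /intrP[m Dm] : ratr q \in (Num.int : {pred algC}).
  exists m; rewrite -(rmorph_int (in_alg K)) /=; congr (_ *: _).
  by apply: (fmorph_inj (ratr : rat -> algC)); rewrite /= Dm [RHS]ratr_int.
apply: Cint_rat_Aint (Crat_rat q) _.
apply: (@root_monic_Aint (map_poly (intr : int -> algC) p)); last 2 first.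
- exact: monic_map.
- by apply/polyOverP => i; rewrite coef_map /=; apply: intr_int.
move: pq0; rewrite -(eq_map_poly (f := in_alg K \o intr)); last first.
  by move=> m; exact: (rmorph_int (in_alg K)).
rewrite map_poly_comp fmorph_root => /(rmorph_root (ratr : {rmorphism rat -> algC})).
by rewrite -map_poly_comp (eq_map_poly (g := intr)) // => m /=; rewrite rmorph_int.
Qed.

Lemma traceB x y : trace (x - y) = trace x - trace y.
Proof. exact: raddfB. Qed.

Lemma traceD x y : trace (x + y) = trace x + trace y.
Proof. exact: raddfD. Qed.

Hypothesis galK : galois 1%VS {:K}.

Lemma trace_OK x : OK x -> rational_integer (trace x).
Proof.
move=> Ox; apply: rational_OK; first exact: mem_galTrace galK (memvf x).
by apply: OK_sum => s _; apply: OK_gal.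
Qed.

(** The integer is the norm of [a], and [c] the product of the nontrivial
    conjugates of [a]. *)
Lemma OK_dvd_int a : OK a -> a != 0 ->
  exists m : int, m != 0 /\ exists2 c, OK c & m%:~R = a * c.
Proof.
move=> Oa nz_a; have [m Dm] : rational_integer (galNorm 1 {:K} a).
  apply: rational_OK; first exact: mem_galNorm galK (memvf a).
  by apply: OK_prod => s _; apply: OK_gal.
exists m; split.
  apply: contra_neq nz_a => m0; apply/eqP.
  by rewrite -(galNorm_eq0 1%AS {:K}%AS) Dm m0.
rewrite -Dm /galNorm (bigD1 (1%g : gal_of {:K})) ?group1 //= gal_id.
by eexists; last reflexivity; apply: OK_prod => s _; apply: OK_gal.
Qed.
End Integers.

(** * Finiteness of the residue rings *)

Section Residues.

Variable K : splittingFieldType rat.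
Local Notation OK := (ring_of_integers K).

(** For a basis [w] of K over Q, the columns [s (w i)], indexed by the
    automorphisms [s], are linearly independent because distinct automorphisms
    are; so some linear combination [u] of the rows is the indicator of the
    identity automorphism, and [x] is the sum of the [u i * trace (x * w i)].
    Clearing denominators in [w] and [u] gives the statement. *)
Lemma trace_coordinates : exists n (w b : 'I_n -> K) (d : int),
  [/\ d != 0, forall i, OK (w i), forall i, OK (b i)
    & forall x, d%:~R * x = \sum_i b i * trace (x * w i)].
Proof.
pose n := \dim {:K}; pose v := vbasis {:K}; pose G := 'Gal({:K} / 1)%g.
have [a nz_a Oav] := fin_all_exists2 (fun i : 'I_n => OK_denominator v`_i).
pose w i : K := (a i)%:~R * v`_i.
pose g (j : 'I_#|G|) := enum_val j.
pose M : 'M[K]_(n, #|G|) := \matrix_(i, j) g j (w i).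
have free_M : row_free M^T.
  rewrite -kermx_eq0; apply/eqP/row_matrixP => k; rewrite row0.
  have: row k (kermx M^T) *m M^T = 0 by rewrite -row_mul mulmx_ker row0.
  move: (row k _) => u uM0; apply/rowP => j; rewrite mxE.
  pose c s := u 0 (enum_rank_in (group1 G) s).
  rewrite -[j](enum_valK_in (group1 G)) -/(c _).
  apply: (gal_independent (P := [in G])) (enum_valP j) => x _.
  rewrite big_enum_val /= (coord_vbasis (memvf x)).
  under eq_bigr => i _.
    rewrite linear_sum mulr_sumr /c enum_valK_in; over.
  rewrite exchange_big big1 //= => i _.
  have := congr1 (fun r : 'rV_n => r 0 i) uM0; rewrite !mxE.
  rewrite (eq_bigr (fun j => (a i)%:~R * (u 0 j * g j v`_i))); last first.
    by move=> j' _; rewrite !mxE rmorphM rmorph_int mulrCA.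
  rewrite -mulr_sumr => /eqP; rewrite mulf_eq0 intrK_eq0 (negPf (nz_a i)) /=.
  move=> /eqP uv0; under eq_bigr do rewrite linearZ -scalerAr.
  by rewrite -scaler_sumr uv0 scaler0.
have full_M : row_full M by rewrite /row_full -mxrank_tr.
pose e := \row_(j < #|G|) (g j == 1%g)%:R : 'rV[K]_#|G|.
have /submxP[u Du] := submx_full e full_M.
have x_trace x : x = \sum_i u 0 i * trace (x * w i).
  transitivity (\sum_(s in G) (s == 1%g)%:R * s x).
    rewrite (bigD1 (1%g : gal_of {:K})) ?group1 //= eqxx mul1r gal_id big1 ?addr0 //.
    by move=> s /andP[_ /negPf->]; rewrite mul0r.
  rewrite big_enum_val; under eq_bigr => j _.
    have := congr1 (fun r : 'rV_ _ => r 0 j) Du; rewrite !mxE => ->.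
    rewrite mulr_suml; under eq_bigr do rewrite mxE -mulrA -rmorphM /= [w _ * _]mulrC.
    over.
  rewrite exchange_big; apply: eq_bigr => i _ /=.
  by rewrite -mulr_sumr; congr (_ * _); rewrite [RHS]big_enum_val.
have [d nz_d Odu] := fin_all_exists2 (fun i => OK_denominator (u 0 i)).
pose D := \prod_i d i.
exists n, w, (fun i => D%:~R * u 0 i), D; split=> // [||x].
- by apply/prodf_neq0 => i _.
- move=> i; rewrite /D (bigD1 i) //= rmorphM /= mulrAC -mulrC.
  exact/OKM/Odu/OK_int.
- by rewrite [in LHS](x_trace x) mulr_sumr; apply: eq_bigr => i _; rewrite mulrA.
Qed.

Variable galK : galois 1%VS {:K}.

(** Elements of the integers of K are congruent modulo [m] as soon as their
    traces against the [w i] above are congruent modulo a suitable rational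
    integer, and there are finitely many such systems of traces. *)
Lemma finite_residues (m : K) : OK m -> m != 0 ->
  exists (T : finType) (f : K -> T),
    forall x y, OK x -> OK y -> f x = f y -> exists2 z, OK z & x - y = m * z.
Proof.
move=> Om nz_m; have [n [w [b [d [nz_d Ow Ob x_trace]]]]] := trace_coordinates.
have [|N [nz_N [c Oc DN]]] := OK_dvd_int galK (OKM Om (OK_int K d)).
  by rewrite mulf_neq0 ?intrK_eq0.
pose t x i : int := xget 0 [set k : int | trace (x * w i) = k%:~R].
have tP x i : OK x -> trace (x * w i) = (t x i)%:~R.
  move=> Ox; have [k Dk] := trace_OK galK (OKM Ox (Ow i)).
  by apply: (@xgetPex _ 0 [set h : int | trace (x * w i) = h%:~R]); exists k.
have lt_t x i : (`|(t x i %% N)%Z| < `|N|.+1)%N.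
  by rewrite ltnS -lez_nat gez0_abs ?modz_ge0 // ltW // ltz_mod.
exists {ffun 'I_n -> 'I_`|N|.+1}, (fun x => [ffun i => Ordinal (lt_t x i)]).
move=> x y Ox Oy /ffunP eq_t.
have t_sub i : (N %| t x i - t y i)%Z.
  have := congr1 val (eq_t i); rewrite !ffunE /= => eq_ti.
  rewrite -eqz_mod_dvd -[(t x i %% N)%Z]gez0_abs ?modz_ge0 // eq_ti.
  by rewrite gez0_abs ?modz_ge0.
exists (c * \sum_i b i * (((t x i - t y i) %/ N)%Z)%:~R).
  by apply: OKM => //; apply: OK_sum => i _; apply: OKM (OK_int _ _).
apply: (mulfI (x := d%:~R)); first by rewrite intrK_eq0.
rewrite x_trace mulrCA mulrA mulrA -DN mulr_sumr; apply: eq_bigr => i _.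
rewrite mulrBl traceB !tP // -rmorphB mulrCA -rmorphM /=.
by rewrite [_ * (_ %/ _)%Z]mulrC divzK.
Qed.
End Residues.

(** * Fractional ideals *)

Section Ideals.

Variable K : splittingFieldType rat.
Local Notation OK := (ring_of_integers K).
Implicit Types (x y c : K) (I J L : set K).

Section Closure.

Variables (I : set K) (fI : fractional_ideal I).

Lemma ideal0 : I 0. Proof. by case: fI => -[]. Qed.
Lemma idealD x y : I x -> I y -> I (x + y).
Proof. by case: fI => -[_ ID] _ _ _; apply: ID. Qed.
Lemma idealM a x : OK a -> I x -> I (a * x).
Proof. by case: fI => _ IM _ _; apply: IM. Qed.
Lemma idealMr x a : I x -> OK a -> I (x * a).
Proof. by rewrite mulrC => Ix Oa; apply: idealM. Qed.

End Closure.

Lemma integral_ideal_fractional I :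
    I 0 -> (forall x y, I x -> I y -> I (x + y)) ->
    (forall a x, OK a -> I x -> I (a * x)) ->
    (exists2 x, I x & x != 0) -> I `<=` OK ->
  fractional_ideal I.
Proof.
move=> I0 ID IM nzI subI; split=> //.
by exists 1; split=> [||x /subI Ox]; rewrite ?mul1r ?oner_eq0 //; apply: OK1.
Qed.

Lemma fractional_OK : fractional_ideal OK.
Proof.
apply: integral_ideal_fractional => //.
- exact: OK0.
- exact: OKD.
- exact: OKM.
- by exists 1; rewrite ?oner_eq0 //; apply: OK1.
Qed.

Lemma fractional_scale c I :
  c != 0 -> fractional_ideal I -> fractional_ideal (ideal_scale c I).
Proof.
move=> nz_c fI; case: (fI) => _ _ [x Ix nz_x] [d [Od nz_d Odx]]; split.
- split=> [|_ _ [u Iu <-] [v Iv <-]]; first by exists 0; rewrite ?mulr0 //; apply: ideal0.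
  by exists (u + v); rewrite ?mulrDr //; apply: idealD.
- by move=> a _ Oa [u Iu <-]; exists (a * u); rewrite 1?mulrCA //; apply: idealM.
- by exists (c * x); [exists x | rewrite mulf_neq0].
have [a nz_a Oac] := OK_denominator c^-1.
have [b nz_b Obc] := OK_denominator c.
exists (b%:~R * d); split=> [||_ [u Iu <-]].
- exact/OKM/Od/OK_int.
- by rewrite mulf_neq0 ?intrK_eq0.
- by rewrite mulrACA; apply/OKM/Odx.
Qed.

Lemma fractional_principal c : c != 0 -> fractional_ideal (ideal_scale c OK).
Proof. by move=> nz_c; apply/fractional_scale/fractional_OK. Qed.

Lemma mem_ideal_mul I J x y : I x -> J y -> ideal_mul I J (x * y).
Proof.
by move=> Ix Jy; exists [:: (x, y)]; split=> [p /[!inE]/eqP-> //|]; rewrite big_seq1.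
Qed.

Lemma ideal_mul0 I J : ideal_mul I J 0.
Proof. by exists [::]; rewrite big_nil. Qed.

Lemma ideal_mulD I J x y :
  ideal_mul I J x -> ideal_mul I J y -> ideal_mul I J (x + y).
Proof.
move=> [s [sIJ ->]] [t [tIJ ->]]; exists (s ++ t); rewrite big_cat; split=> // p.
by rewrite mem_cat => /orP[/sIJ|/tIJ].
Qed.

(** The universal property of the product of ideals, through which all
    inclusions out of a product are established. *)
Lemma ideal_mul_subset I J L :
    L 0 -> (forall x y, L x -> L y -> L (x + y)) ->
  (forall x y, I x -> J y -> L (x * y)) -> ideal_mul I J `<=` L.
Proof.
move=> L0 LD LM _ [s [sIJ ->]]; rewrite big_seq.
by elim/big_ind: _ => // p /sIJ[]; apply: LM.
Qed.

Lemma ideal_mulC I J : ideal_mul I J = ideal_mul J I.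
Proof.
wlog suff subIJ : I J / ideal_mul I J `<=` ideal_mul J I.
  by apply/seteqP; split; apply: subIJ.
apply: ideal_mul_subset => [||x y Ix Jy]; first exact: ideal_mul0.
- exact: ideal_mulD.
- by rewrite mulrC; apply: mem_ideal_mul.
Qed.

Lemma ideal_mulA I J L :
  ideal_mul I (ideal_mul J L) = ideal_mul (ideal_mul I J) L.
Proof.
wlog suff subIJ : I J L / ideal_mul I (ideal_mul J L) `<=` ideal_mul (ideal_mul I J) L.
  apply/seteqP; split=> //.
  by rewrite ideal_mulC [X in _ `<=` X]ideal_mulC [ideal_mul I J]ideal_mulC
             [ideal_mul J L]ideal_mulC.
apply: ideal_mul_subset => [||x y Ix]; [exact: ideal_mul0 | exact: ideal_mulD |].
pose M z := ideal_mul (ideal_mul I J) L (x * z).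
move: y; rewrite -/(_ `<=` M); apply: ideal_mul_subset => [|y z|y z Jy Lz]; rewrite /M.
- by rewrite mulr0; apply: ideal_mul0.
- by rewrite mulrDr; apply: ideal_mulD.
- by rewrite mulrA; apply/mem_ideal_mul => //; apply: mem_ideal_mul.
Qed.

Lemma ideal_mul1 I : fractional_ideal I -> ideal_mul OK I = I.
Proof.
move=> fI; apply/seteqP; split=> [|x Ix]; last first.
  by rewrite -[x]mul1r; apply: mem_ideal_mul => //; apply: OK1.
by apply: ideal_mul_subset; [exact: ideal0 | exact: idealD | exact: idealM].
Qed.

Lemma fractional_mul I J :
  fractional_ideal I -> fractional_ideal J -> fractional_ideal (ideal_mul I J).
Proof.
move=> fI fJ; case: (fI) (fJ) => _ _ [x Ix nz_x] [d [Od nz_d Odx]].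
case=> _ _ [y Jy nz_y] [e [Oe nz_e Oey]]; split.
- by split; [exact: ideal_mul0 | exact: ideal_mulD].
- move=> a + Oa; rewrite -/(_ `<=` (fun z => ideal_mul I J (a * z))).
  apply: ideal_mul_subset => [|u v|u v Iu Jv] /=.
  + by rewrite mulr0; apply: ideal_mul0.
  + by rewrite mulrDr; apply: ideal_mulD.
  + by rewrite mulrA; apply: mem_ideal_mul => //; apply: idealM.
- by exists (x * y); [exact: mem_ideal_mul | rewrite mulf_neq0].
- exists (d * e); split; [exact: OKM | by rewrite mulf_neq0 |].
  rewrite -/(_ `<=` (fun z => OK (d * e * z))).
  apply: ideal_mul_subset => [|u v|u v Iu Jv].
  + by rewrite mulr0; apply: OK0.
  + by rewrite mulrDr; apply: OKD.
  + by rewrite mulrACA; apply: OKM; [exact: Odx | exact: Oey].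
Qed.

Lemma ideal_scale_mul c I :
  fractional_ideal I -> ideal_scale c I = ideal_mul (ideal_scale c OK) I.
Proof.
move=> fI; apply/seteqP; split=> [_ [x Ix <-]|].
  by apply: mem_ideal_mul => //; exists 1; rewrite ?mulr1 //; apply: OK1.
apply: ideal_mul_subset => [|_ _ [x Ix <-] [y Iy <-]|_ y [x Ox <-] Iy].
- by exists 0; rewrite ?mulr0 //; apply: ideal0.
- by exists (x + y); rewrite ?mulrDr //; apply: idealD.
- by exists (x * y); rewrite ?mulrA //; apply: idealM.
Qed.

Lemma fractional_inv I : fractional_ideal I -> fractional_ideal (ideal_inv I).
Proof.
case=> [_ IM [x Ix nz_x] [d [Od nz_d Odx]]]; split.
- split=> [y _|y z Iy Iz t It]; first by rewrite mul0r; apply: OK0.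
  by rewrite mulrDl; apply: OKD; [exact: Iy | exact: Iz].
- by move=> a y Oa Iy t It; rewrite -mulrA; apply: OKM => //; apply: Iy.
- by exists d.
have [a nz_a Oax] := OK_denominator x.
exists (a%:~R * x); split=> //; first by rewrite mulf_neq0 ?intrK_eq0.
move=> y Iy; rewrite mulrC; apply: (Iy (a%:~R * x)).
by apply: IM => //; apply: OK_int.
Qed.

End Ideals.

(** * Prime ideals and invertibility *)

Lemma pigeonhole (T : finType) (f : nat -> T) :
  exists i j, (i < j)%N /\ f i = f j.
Proof.
pose g (i : 'I_#|T|.+1) := f i.
have /injectivePn[i [j ne_ij eq_g]] : ~~ injectiveb g.
  by apply/injectiveP => /leq_card; rewrite card_ord ltnn.
by case: (ltngtP i j) ne_ij => [lt_ij|lt_ji|/val_inj->]; rewrite ?eqxx //;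
  [exists i, j | exists j, i].
Qed.

Section Invertibility.

Variables (K : splittingFieldType rat) (galK : galois 1%VS {:K}).
Local Notation OK := (ring_of_integers K).
Implicit Types (x y a b c : K) (I J P Q : set K).

(** Noetherian induction. An ideal that contains [m] is determined by its image
    among the finitely many residues modulo [m], so a strictly larger ideal
    misses fewer residues. *)
Lemma integral_ideal_ind (F : set K -> Prop) :
    (forall I, fractional_ideal I -> I `<=` OK ->
       (forall J, fractional_ideal J -> J `<=` OK -> I `<=` J -> J <> I -> F J) ->
     F I) ->
  forall I, fractional_ideal I -> I `<=` OK -> F I.
Proof.
move=> IH I fI subI; case: (fI) => _ _ [m Im nz_m] _.
have [T [f fP]] := finite_residues galK (subI m Im) nz_m.
pose res J : {set T} := [set t | `[< exists2 x, J x & f x = t >]]%SET.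
have [n] := ubnP #|~: res I|.
elim: n I fI subI Im => // n IHn I fI subI Im le_res; apply: IH => // J fJ subJ IJ neJI.
apply: IHn => //; first exact: IJ.
rewrite -ltnS; apply: leq_trans le_res; rewrite ltnS; apply: proper_card.
rewrite finset.properEneq finset.setCS andbC; apply/andP; split.
  apply/fintype.subsetP => t; rewrite !inE => -[x Ix Dt].
  by exists x => //; apply: IJ.
apply/eqP => /finset.setC_inj eq_res; apply: neJI; apply/seteqP; split=> // y Jy.
have: f y \in res I by rewrite -eq_res inE; apply/asboolP; exists y.
rewrite inE => /asboolP[x Ix eq_f].
have [|||z Oz Dz] := fP y x; [exact: subJ | exact: subI | by [] |].
by rewrite -(subrK x y) Dz; apply: idealD => //; apply: idealMr.
Qed.

Lemma prime_idealX P x n : prime_ideal P -> OK x -> P (x ^+ n) -> P x.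
Proof.
move=> [fP subP nP1 primeP] Ox; elim: n => [/nP1//|n IHn].
by rewrite exprS => /primeP[||//|]; [exact: Ox | exact: OKX | exact: IHn].
Qed.

(** Some two powers [x ^+ i] and [x ^+ j], with [i < j], are congruent modulo
    [P]; cancelling [x ^+ i] gives an inverse of [x] modulo [P]. *)
Lemma prime_ideal_inverse P x : prime_ideal P -> OK x -> ~ P x ->
  exists2 z, OK z & P (1 - x * z).
Proof.
move=> primeP Ox nPx; have [fP subP nP1 PM] := primeP.
case: (fP) => _ _ [m Pm nz_m] _.
have [T [f fE]] := finite_residues galK (subP m Pm) nz_m.
have [i [j [lt_ij eq_f]]] := pigeonhole (fun n => f (x ^+ n)).
have [z Oz Dz] := fE _ _ (OKX i Ox) (OKX j Ox) eq_f.
exists (x ^+ (j - i).-1); first exact: OKX.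
rewrite -exprS prednK ?subn_gt0 //.
have : P (x ^+ i * (1 - x ^+ (j - i))).
  by rewrite mulrBr mulr1 -exprD subnKC ?(ltnW lt_ij) // Dz; apply: idealMr.
case/PM => //; [exact: OKX | by apply: OKB; [exact: OK1 | exact: OKX] |].
by move/(prime_idealX primeP Ox).
Qed.

(** Nonzero primes are maximal, as the integers modulo [P] form a field. *)
Lemma prime_ideal_subset P Q : prime_ideal P -> prime_ideal Q -> P `<=` Q -> P = Q.
Proof.
move=> primeP [fQ subQ nQ1 _] subPQ; apply/seteqP; split=> // x Qx.
apply: contrapT => nPx; apply: nQ1.
have [z Oz Pxz] := prime_ideal_inverse primeP (subQ x Qx) nPx.
by rewrite -(subrK (x * z) 1); apply: idealD => //; [exact: subPQ | exact: idealMr].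
Qed.

(** A maximal proper ideal [I] is prime: if [x] is not in [I], then [1] is in
    [I + x OK], so that [y] is in [I] whenever [x y] is. *)
Lemma subset_prime_ideal I : fractional_ideal I -> I `<=` OK -> ~ I 1 ->
  exists2 P, prime_ideal P & I `<=` P.
Proof.
move: I; apply: integral_ideal_ind => I fI subI IH nI1.
have [[J [fJ subJ IJ neJI nJ1]]|maxI] :=
    pselect (exists J, [/\ fractional_ideal J, J `<=` OK, I `<=` J, J <> I & ~ J 1]).
  by have [P primeP JP] := IH J fJ subJ IJ neJI nJ1; exists P => // x /IJ/JP.
exists I => //; split=> // x y Ox Oy Ixy.
have [|nIx] := pselect (I x); [by left | right].
pose J := [set z | exists u v, [/\ I u, OK v & z = u + x * v]].
have IJ : I `<=` J.
  by move=> u Iu; exists u, 0; split; rewrite ?mulr0 ?addr0 //; apply: OK0.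
have subJ : J `<=` OK.
  by move=> _ [u [v [Iu Ov ->]]]; apply: OKD; [exact: subI | exact: OKM].
have fJ : fractional_ideal J.
  apply: integral_ideal_fractional => //.
  - exact: IJ (ideal0 fI).
  - move=> _ _ [u [v [Iu Ov ->]]] [u' [v' [Iu' Ov' ->]]].
    exists (u + u'), (v + v'); split; [exact: idealD | exact: OKD |].
    by rewrite mulrDr addrACA.
  - move=> a _ Oa [u [v [Iu Ov ->]]]; exists (a * u), (a * v).
    by split; [exact: idealM | exact: OKM | rewrite mulrDr [a * (x * _)]mulrCA].
  - by case: (fI) => _ _ [u Iu nz_u] _; exists u => //; apply: IJ.
have neJI : J <> I.
  move=> eqJI; apply: nIx; rewrite -eqJI; exists 0, 1.
  by split; rewrite ?mulr1 ?add0r //; [exact: ideal0 | exact: OK1].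
have [u [v [Iu Ov D1]]] : J 1 by apply: contrapT => nJ1; apply: maxI; exists J.
rewrite -[y]mul1r D1 mulrDl mulrAC; apply: idealD => //; first exact: idealMr.
exact: idealMr.
Qed.

(** For a nonzero [a] in [P], a maximal one among the ideals
    [(a : b) = {z | z b \in a OK}] contained in [P] is prime, hence equal to [P];
    then [b / a] belongs to the inverse of [P], and is not integral. *)
Lemma prime_ideal_inv_nonintegral P : prime_ideal P ->
  exists2 x, ideal_inv P x & ~ OK x.
Proof.
move=> primeP; have [fP subP nP1 PM] := primeP.
case: (fP) => _ _ [a Pa nz_a] _; have Oa := subP a Pa.
pose colon b := [set z | OK z /\ exists2 y, OK y & z * b = a * y].
have colonO b : colon b `<=` OK by move=> z [].
have colon_fractional b : OK b -> fractional_ideal (colon b).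
  move=> Ob; apply: integral_ideal_fractional => //.
  - by split; [exact: OK0 | exists 0; rewrite ?mulr0 ?mul0r //; apply: OK0].
  - move=> u v [Ou [u' Ou' Du]] [Ov [v' Ov' Dv]]; split; first exact: OKD.
    by exists (u' + v'); [exact: OKD | rewrite mulrDl mulrDr Du Dv].
  - move=> c u Oc [Ou [u' Ou' Du]]; split; first exact: OKM.
    by exists (c * u'); [exact: OKM | rewrite -mulrA Du mulrCA].
  - by exists a => //; split=> //; exists b.
have colonS b c : OK c -> colon b `<=` colon (b * c).
  move=> Oc z [Oz [y Oy Dz]]; split=> //; exists (y * c); first exact: OKM.
  by rewrite !mulrA Dz.
suff [b Ob DP] : exists2 b, OK b & colon b = P.
  exists (b / a) => [y|].
    rewrite -{1}DP => -[Oy [z Oz Dz]].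
    by rewrite mulrAC [b * y]mulrC Dz mulrAC divff ?mul1r.
  move=> Oba; apply: nP1; rewrite -DP; split; first exact: OK1.
  by exists (b / a); rewrite // mul1r mulrCA divff ?mulr1.
have colon1P : colon 1 `<=` P.
  by move=> z [Oz [y Oy]]; rewrite mulr1 => ->; apply: idealMr.
have find I : fractional_ideal I -> I `<=` OK ->
    forall b, OK b -> colon b = I -> I `<=` P -> exists2 b, OK b & colon b = P.
  move: I; apply: integral_ideal_ind => I fI subI IH b Ob DI IP.
  have [primeI|nprimeI] := pselect (prime_ideal I).
    by exists b => //; rewrite DI; apply: prime_ideal_subset.
  have [[c Oc [cP neI]]|maxI] :=
      pselect (exists2 c, OK c & colon (b * c) `<=` P /\ colon (b * c) <> I).
    apply: (IH (colon (b * c))) (b * c) _ _ _ => //; try exact: OKM.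
      exact/colon_fractional/OKM.
    by rewrite -DI; apply: colonS.
  have maxIE c : OK c -> colon (b * c) `<=` P -> colon (b * c) = I.
    by move=> Oc cP; apply: contrapT => neI; apply: maxI; exists c.
  case: nprimeI; split=> // [/IP//|x y Ox Oy Ixy].
  have [|nIx] := pselect (I x); [by left | right].
  have [|nsubP] := pselect (colon (b * x) `<=` P).
    move=> /(maxIE x Ox) <-; split=> //; move: Ixy; rewrite -DI => -[_ [z Oz Dz]].
    by exists z; rewrite // -Dz [b * x]mulrC mulrA [y * x]mulrC.
  (* Some [s] outside [P] satisfies [s x b \in a OK]; since [(a : b s)] is still
     contained in [P], it equals [I] by maximality, and it contains [x]. *)
  case: nsubP => s [Os [t Ot Dt]]; apply: contrapT => nPs; apply: nIx.
  have [u Ou Du] : exists2 u, OK u & x * (b * s) = a * u.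
    by exists t => //; rewrite -Dt mulrCA [x * s]mulrC mulrCA.
  rewrite -(maxIE s) //; first by split=> //; exists u.
  move=> z [Oz [v Ov Dv]]; have: I (z * s).
    by rewrite -DI; split; [exact: OKM | exists v; rewrite // -mulrA [s * b]mulrC].
  by case/IP/PM.
apply: (find (colon 1)) _ _ 1 _ erefl colon1P => //; last exact: OK1.
exact/colon_fractional/OK1.
Qed.

(** By finiteness of the residues modulo [c], two of the [c * x ^+ n] are
    congruent modulo [c]; this is a monic equation for [x]. *)
Lemma almost_integral c x : c != 0 -> (forall n, OK (c * x ^+ n)) -> OK x.
Proof.
move=> nz_c Ocx; have Oc : OK c by have := Ocx 0%N; rewrite mulr1.
have [T [f fE]] := finite_residues galK Oc nz_c.
have [i [j [lt_ij eq_f]]] := pigeonhole (fun n => f (c * x ^+ n)).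
have [z Oz] := fE _ _ (Ocx i) (Ocx j) eq_f.
rewrite -mulrBr => /(mulfI nz_c) Dz.
pose p : {poly K} := 'X^j - ('X^i - z%:P).
have size_q : (size ('X^i - z%:P)%R < size ('X^j : {poly K}))%N.
  rewrite size_polyXn ltnS (leq_trans (size_polyD _ _)) // geq_max size_polyN.
  by rewrite size_polyXn lt_ij (leq_trans (size_polyC_leq1 _)) // (leq_ltn_trans _ lt_ij).
apply: (@OK_monic_root _ p).
- by rewrite monicE lead_coefDl ?size_polyN // lead_coefXn.
- by rewrite rootE !hornerE -Dz subKr subrr.
- move=> k; rewrite !(coefB, coefXn, coefC); apply: OKB; first exact: OK_nat.
  by apply: OKB; [exact: OK_nat | case: eqP => // _; apply: OK0].
Qed.

(** If the product [J] of [I] and its inverse were proper, it would lie in a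
    prime [P]; an element [x] of the inverse of [P] would then map the inverse
    of [I] to itself, and so would be integral. *)
Lemma ideal_mul_inv I : fractional_ideal I -> ideal_mul I (ideal_inv I) = OK.
Proof.
move=> fI; have fV := fractional_inv fI; pose J := ideal_mul I (ideal_inv I).
have subJ : J `<=` OK.
  apply: ideal_mul_subset; [exact: OK0 | exact: OKD |].
  by move=> x y Ix Vy; rewrite mulrC; apply: Vy.
have fJ : fractional_ideal J by apply: fractional_mul.
suff J1 : J 1.
  apply/seteqP; split=> // x Ox; rewrite -[x]mulr1; exact: idealM.
apply: contrapT => nJ1; have [P primeP JP] := subset_prime_ideal fJ subJ nJ1.
have [x Px] := prime_ideal_inv_nonintegral primeP; apply.
case: (fI) => _ _ [u Iu nz_u] [d [Od nz_d Odx]].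
have Vx n : ideal_inv I (x ^+ n * d).
  elim: n => [|n IHn]; first by rewrite mul1r.
  move=> t It; rewrite exprS -!mulrA; apply/Px/JP.
  by rewrite mulrA mulrC; apply: mem_ideal_mul.
apply: (@almost_integral (d * u)) => [|n]; first by rewrite mulf_neq0.
by rewrite mulrC mulrA; apply: Vx.
Qed.

End Invertibility.

(** * The group of fractional ideals *)

Section FractionalIdealType.

Variable K : splittingFieldType rat.

(** The parameter [galK] is carried by the type because the group structure,
    which is inferred from the type alone, rests on it. *)
Record fideal (galK : galois 1%VS {:K}) : Type :=
  Fideal {fideal_set :> set K; _ : `[< fractional_ideal fideal_set >]}.

Variable galK : galois 1%VS {:K}.

HB.instance Definition _ := [isSub for @fideal_set galK].
HB.instance Definition _ := [Choice of fideal galK by <:].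

Implicit Types X Y Z : fideal galK.

Lemma fidealP X : fractional_ideal X. Proof. by case: X => I fI; apply/asboolP. Qed.

Lemma fideal_inj X Y : X = Y :> set K -> X = Y. Proof. exact: val_inj. Qed.

Definition mk_fideal I (fI : fractional_ideal I) : fideal galK :=
  Fideal galK (asboolT fI).

Definition fideal_add X Y := mk_fideal (fractional_mul (fidealP X) (fidealP Y)).
Definition fideal_zero := mk_fideal (fractional_OK K).
Definition fideal_opp X := mk_fideal (fractional_inv (fidealP X)).

Lemma fideal_addA : associative fideal_add.
Proof. by move=> X Y Z; apply/fideal_inj/ideal_mulA. Qed.
Lemma fideal_addC : commutative fideal_add.
Proof. by move=> X Y; apply/fideal_inj/ideal_mulC. Qed.
Lemma fideal_add0 : left_id fideal_zero fideal_add.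
Proof. by move=> X; apply/fideal_inj/ideal_mul1/fidealP. Qed.
Lemma fideal_addN : left_inverse fideal_zero fideal_opp fideal_add.
Proof.
move=> X; apply/fideal_inj; rewrite [LHS]ideal_mulC.
exact: (ideal_mul_inv galK (fidealP X)).
Qed.

(** The group of fractional ideals is written additively, so that the
    exponents of the prime ideals become integer coefficients. *)
HB.instance Definition _ := GRing.isZmodule.Build (fideal galK)
  fideal_addA fideal_addC fideal_add0 fideal_addN.

End FractionalIdealType.

(** * Factorization into prime ideals *)

Section Factorization.

Variables (K : splittingFieldType rat) (galK : galois 1%VS {:K}).
Local Notation OK := (ring_of_integers K).
Local Notation fideal := (fideal galK).
Implicit Types (I P Q : set K) (X Y Z : fideal) (e : set K -> int).

Lemma fideal_setD X Y : X + Y = ideal_mul X Y :> set K. Proof. by []. Qed.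
Lemma fideal_set0 : (0 : fideal) = OK :> set K. Proof. by []. Qed.
Lemma fideal_setN X : - X = ideal_inv X :> set K. Proof. by []. Qed.

Lemma fideal_set_mulrz X (n : int) : X *~ n = ideal_exp X n :> set K.
Proof.
have natX Y k : Y *+ k = iter k (ideal_mul Y) OK :> set K.
  by elim: k => [|k IHk] //; rewrite mulrS fideal_setD IHk.
by case: n => k; [exact: natX | rewrite NegzE mulrNz -mulNrn; exact: natX].
Qed.

(** Total, with the ideal [OK] as default value, because families of
    exponents are indexed by arbitrary sets. *)
Definition to_fideal I : fideal := insubd (0 : fideal) I.

Lemma to_fidealK I : fractional_ideal I -> to_fideal I = I :> set K.
Proof. by move=> fI; apply: insubdK; apply/asboolP. Qed.

Definition factorizes X e := exists s : seq (set K),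
  [/\ uniq s, forall P, P \in s -> prime_ideal P, forall P, P \notin s -> e P = 0
    & X = \sum_(P <- s) to_fideal P *~ e P].

Lemma ideal_factorizationE X e : ideal_factorization X e <-> factorizes X e.
Proof.
have DX s : (forall P, P \in s -> prime_ideal P) ->
    (\sum_(P <- s) to_fideal P *~ e P : fideal) =
      \big[@ideal_mul K/OK]_(P <- s) ideal_exp P (e P) :> set K.
  move=> primes; rewrite (big_morph _ fideal_setD fideal_set0).
  apply: eq_big_seq => P /primes[fP _ _ _].
  by rewrite fideal_set_mulrz to_fidealK.
split=> -[s [uniq_s primes e0 sumX]]; exists s; split=> //.
  by apply: fideal_inj; rewrite DX.
by rewrite sumX DX.
Qed.

Lemma sum_subset s t e : uniq s -> uniq t -> {subset s <= t} ->
    (forall P, P \notin s -> e P = 0) ->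
  \sum_(P <- s) to_fideal P *~ e P = \sum_(P <- t) to_fideal P *~ e P.
Proof.
move=> uniq_s uniq_t sub_st e0; rewrite [RHS](bigID [in s]) /=.
rewrite [X in _ = _ + X]big1 ?addr0 => [|P /e0->]; last by rewrite mulr0z.
rewrite -[RHS]big_filter; apply: perm_big; apply: uniq_perm => //.
  exact: filter_uniq.
move=> P; rewrite mem_filter /= andbC.
by case: (boolP (P \in s)) => [/sub_st->|]; rewrite ?andbF.
Qed.

Lemma factorizes0 : factorizes 0 (fun=> 0).
Proof. by exists [::]; rewrite big_nil. Qed.

Lemma factorizesN X e : factorizes X e -> factorizes (- X) (fun P => - e P).
Proof.
move=> [s [uniq_s primes e0 ->]]; exists s; split=> // [P /e0->|].
  by rewrite oppr0.
by rewrite -sumrN; apply: eq_bigr => P _; rewrite mulrNz.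
Qed.

Lemma factorizesD X Y e f :
  factorizes X e -> factorizes Y f -> factorizes (X + Y) (fun P => e P + f P).
Proof.
move=> [s [uniq_s primes_s e0 ->]] [t [uniq_t primes_t f0 ->]].
pose r := undup (s ++ t); have mem_r P : (P \in r) = (P \in s) || (P \in t).
  by rewrite mem_undup mem_cat.
exists r; split=> [|P|P|].
- exact: undup_uniq.
- by rewrite mem_r => /orP[/primes_s|/primes_t].
- by rewrite mem_r negb_or => /andP[/e0-> /f0->].
rewrite (@sum_subset s r) ?undup_uniq //; last by move=> P Ps; rewrite mem_r Ps.
rewrite (@sum_subset t r) ?undup_uniq //; last by move=> P Pt; rewrite mem_r Pt orbT.
by rewrite -big_split; apply: eq_bigr => P _; rewrite mulrzDr.
Qed.

Lemma factorizes_prime P : prime_ideal P ->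
  factorizes (to_fideal P) (fun Q => (Q == P)%:Z).
Proof.
move=> primeP; exists [:: P]; split=> // [Q|Q|].
- by rewrite inE => /eqP->.
- by rewrite inE => /negPf->.
- by rewrite big_seq1 eqxx.
Qed.

(** A proper integral ideal [I] lies in a prime [P], and the quotient of [I] by [P]
    is again integral and strictly contains [I]. *)
Lemma integral_factorizes X : X `<=` OK -> exists e, factorizes X e.
Proof.
suff fact I : fractional_ideal I -> I `<=` OK ->
    forall X, X = I :> set K -> exists e, factorizes X e.
  by move=> subX; exact: fact (fidealP X) subX X erefl.
move: I; apply: (integral_ideal_ind galK) => I fI subI IH {}X DX.
have [I1|nI1] := pselect (I 1).
  exists (fun=> 0); suff -> : X = 0 by exact: factorizes0.
  apply: fideal_inj; rewrite DX; apply/seteqP; split=> // x Ox.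
  by rewrite -[x]mulr1; apply: idealM.
have [P primeP IP] := subset_prime_ideal galK fI subI nI1.
have [fP subP nP1 _] := primeP.
pose Y := X - to_fideal P.
have DY : Y = ideal_mul I (ideal_inv P) :> set K.
  by rewrite /Y fideal_setD fideal_setN to_fidealK // DX.
have subY : Y `<=` OK.
  rewrite DY; apply: ideal_mul_subset; [exact: OK0 | exact: OKD |].
  by move=> x y Ix Vy; rewrite mulrC; apply/Vy/IP.
have IY : I `<=` Y.
  move=> x Ix; rewrite DY -[x]mulr1; apply: mem_ideal_mul => //.
  by move=> y Py; rewrite mul1r; apply: subP.
have neYI : Y <> I :> set K.
  rewrite -DX => /fideal_inj/eqP; rewrite -subr_eq0 addrAC subrr sub0r oppr_eq0.
  move=> /eqP/(congr1 (@fideal_set _ _)); rewrite to_fidealK // => DP.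
  by apply: nP1; rewrite DP; exact: OK1.
have [e eY] := IH Y (fidealP Y) subY IY neYI Y erefl.
exists (fun Q => e Q + (Q == P)%:Z).
by rewrite -[X](subrK (to_fideal P)); apply/factorizesD/factorizes_prime.
Qed.

(** For a denominator [d] of [X], both [d OK] and [d X] are integral. *)
Lemma exists_factorization X : exists e, factorizes X e.
Proof.
case: (fidealP X) => _ _ _ [d [Od nz_d Odx]].
pose D : fideal := mk_fideal galK (fractional_principal nz_d).
have subD : D `<=` OK by move=> _ [x Ox <-]; apply: OKM.
have subDX : D + X `<=` OK.
  rewrite fideal_setD -ideal_scale_mul; last exact: fidealP.
  by move=> _ [x Xx <-]; exact: Odx.
have [e eD] := integral_factorizes subD; have [f fDX] := integral_factorizes subDX.
exists (fun P => f P + - e P).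
by rewrite -(addKr D X) addrC; apply/factorizesD/factorizesN.
Qed.

(** The fractional ideals that are units at [P]: quotients of two integral ideals
    not contained in [P]. They form a subgroup which contains the primes
    other than [P], but no power of [P] with a positive exponent; this makes
    the exponent of [P] in a factorization unique. *)
Definition unit_at P X := exists A B : fideal,
  [/\ A `<=` OK, B `<=` OK, ~ (A `<=` P), ~ (B `<=` P) & X + B = A].

Lemma integral_fidealD X Y : X `<=` OK -> Y `<=` OK -> X + Y `<=` OK.
Proof.
move=> subX subY; rewrite fideal_setD.
apply: ideal_mul_subset; [exact: OK0 | exact: OKD | move=> x y /subX Ox /subY Oy].
exact: OKM.
Qed.

Section UnitAt.

Variables (P : set K) (primeP : prime_ideal P).

Lemma not_subset_primeD X Y :
  X `<=` OK -> Y `<=` OK -> ~ (X `<=` P) -> ~ (Y `<=` P) -> ~ (X + Y `<=` P).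
Proof.
case: primeP => _ _ _ PM subX subY /nonsubset[x [Xx nPx]] /nonsubset[y [Yy nPy]] subXY.
have /PM[||//|//] : P (x * y) by apply: subXY; apply: mem_ideal_mul.
- exact: subX.
- exact: subY.
Qed.

Lemma unit_at0 : unit_at P 0.
Proof.
have nsubP : ~ ((0 : fideal) `<=` P).
  by move=> subP; case: primeP => _ _ + _; apply; apply: subP; exact: OK1.
by exists 0, 0; split; rewrite // addr0.
Qed.

Lemma unit_atD X Y : unit_at P X -> unit_at P Y -> unit_at P (X + Y).
Proof.
move=> [A [B [subA subB nA nB DA]]] [A' [B' [subA' subB' nA' nB' DA']]].
exists (A + A'), (B + B'); split; last by rewrite addrACA DA DA'.
- exact: integral_fidealD.
- exact: integral_fidealD.
- exact: not_subset_primeD.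
- exact: not_subset_primeD.
Qed.

Lemma unit_atN X : unit_at P X -> unit_at P (- X).
Proof.
by move=> [A [B [subA subB nA nB DA]]]; exists B, A; split; rewrite // -DA addKr.
Qed.

Lemma unit_at_mulrz X (n : int) : unit_at P X -> unit_at P (X *~ n).
Proof.
move=> uX; have natX k : unit_at P (X *+ k).
  by elim: k => [|k IHk]; [exact: unit_at0 | rewrite mulrS; apply: unit_atD].
case: n => k; first exact: natX.
by rewrite NegzE mulrNz; apply/unit_atN/natX.
Qed.

Lemma unit_at_prime Q : prime_ideal Q -> Q != P -> unit_at P (to_fideal Q).
Proof.
move=> primeQ neQP; have [fQ subQ _ _] := primeQ.
have [A0 [B0 [_ sub0 _ n0 _]]] := unit_at0; have nQ : ~ (Q `<=` P).
  by move=> QP; case/eqP: neQP; apply: (prime_ideal_subset galK).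
exists (to_fideal Q), 0; split; rewrite ?to_fidealK ?addr0 //.
by move=> subP; case: primeP => _ _ + _; apply; apply: subP; exact: OK1.
Qed.

Lemma prime_not_unit_at (n : int) : 0 < n -> ~ unit_at P (to_fideal P *~ n).
Proof.
case: n => // -[|n] // _ [A [B [_ subB nA _ DA]]]; apply: nA.
have [fP subP _ _] := primeP.
have subPn : to_fideal P *+ n + B `<=` OK.
  apply: integral_fidealD => //; elim: n {DA} => [|n IHn] //.
  by rewrite mulrS; apply: integral_fidealD; rewrite ?to_fidealK.
rewrite -DA -pmulrn mulrS -addrA fideal_setD to_fidealK //.
apply: ideal_mul_subset; [exact: ideal0 | exact: idealD |].
by move=> x y Px /subPn Oy; apply: idealMr.
Qed.

End UnitAt.

(** If the exponent of [P] were positive, the corresponding power of [P] would be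
    the inverse of a product of powers of other primes, hence a unit at [P]. *)
Lemma factorizes0_eq0 e : factorizes 0 e -> forall P, e P = 0.
Proof.
suff e_le0 f P : factorizes 0 f -> 0 < f P -> False.
  move=> e_fact P; case: (ltrgtP (e P) 0) => // [eP_lt0|eP_gt0].
    have := factorizesN e_fact; rewrite oppr0 => /(e_le0 _ P); case.
    by rewrite oppr_gt0; exact: eP_lt0.
  by case: (e_le0 _ _ e_fact eP_gt0).
move=> [s [uniq_s primes f0 sum0]] fP_gt0.
have Ps : P \in s by apply: contraLR fP_gt0 => /f0->; rewrite ltxx.
apply: (prime_not_unit_at (primes P Ps) fP_gt0).
move/eqP: sum0; rewrite eq_sym (bigD1_seq P) //= addr_eq0 => /eqP->.
apply: unit_atN; rewrite big_seq_cond; elim/big_ind: _.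
- exact/unit_at0/primes.
- by move=> X Y; apply: (unit_atD (primes P Ps)).
- move=> Q /andP[Qs neQP]; apply: (unit_at_mulrz (primes P Ps)).
  by apply: (unit_at_prime (primes P Ps)) => //; apply: primes.
Qed.

Lemma valuationE X e P : factorizes X e -> valuation P X = e P.
Proof.
move=> eX; rewrite /valuation.
have : ideal_factorization X (xget (fun=> 0) [set f | ideal_factorization X f]).
  by apply: xgetPex; exists e; apply/ideal_factorizationE.
move: (xget _ _) => f /ideal_factorizationE fX.
have := factorizesD fX (factorizesN eX); rewrite subrr => /factorizes0_eq0/(_ P)/eqP.
by rewrite subr_eq0 => /eqP.
Qed.

Lemma even_valuationP X :
  (forall P, prime_ideal P -> (2 %| valuation P X)%Z) <-> exists Y, X = Y + Y.
Proof.
have [e eX] := exists_factorization X.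
split=> [evenX|[Y DX] P primeP]; last first.
  have [f fY] := exists_factorization Y.
  rewrite DX (valuationE P (factorizesD fY fY)) -mulr2n -[f P *+ 2]mulr_natr.
  by rewrite dvdz_mull.
have [s [_ primes _ DX]] := eX.
exists (\sum_(P <- s) to_fideal P *~ (e P %/ 2)%Z).
rewrite DX -big_split; apply: eq_big_seq => P Ps.
rewrite /= -mulrzDr -mulr2n -[_ *+ 2]mulr_natr divzK // -(valuationE P eX).
exact/evenX/primes.
Qed.

End Factorization.

(** * The inverse different and duality *)

Section Duality.

Variables (K : splittingFieldType rat) (galK : galois 1%VS {:K}).
Local Notation OK := (ring_of_integers K).
Local Notation D := (inverse_different K).
Implicit Types (x y a b c : K) (I : set K).

Lemma rational_integerD x y :
  rational_integer x -> rational_integer y -> rational_integer (x + y).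
Proof. by move=> [m ->] [n ->]; exists (m + n); rewrite rmorphD. Qed.

(** The common denominator is the [d] of [trace_coordinates], which writes [d x] as
    a combination, with integral coefficients, of traces that are rational
    integers when [x] is in the inverse different. *)
Lemma fractional_inverse_different : fractional_ideal D.
Proof.
have [n [w [b [d [nz_d Ow Ob x_trace]]]]] := trace_coordinates K.
split.
- split=> [y _|x y Dx Dy z Oz].
    by rewrite mul0r; apply: trace_OK => //; apply: OK0.
  by rewrite mulrDl traceD; apply: rational_integerD; [exact: Dx | exact: Dy].
- by move=> a x Oa Dx y Oy; rewrite -mulrA mulrCA; apply/Dx/OKM.
- by exists 1; rewrite ?oner_eq0 // => y Oy; rewrite mul1r; apply: trace_OK.
exists d%:~R; split; rewrite ?intrK_eq0 //; first exact: OK_int.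
move=> x Dx; rewrite x_trace; apply: OK_sum => i _; apply: OKM => //.
by have [m ->] := Dx (w i) (Ow i); apply: OK_int.
Qed.

(** As [I] is a module over the integers, [trace] is integral on [a x I] exactly
    when [a x I] lies in the inverse different; invertibility of [I] turns this
    into [a x] being in the inverse different times the inverse of [I]. *)
Lemma dual_latticeE I a : fractional_ideal I -> a != 0 ->
  dual_lattice I a = ideal_scale a^-1 (ideal_mul D (ideal_inv I)).
Proof.
move=> fI nz_a; have fD := fractional_inverse_different.
apply/seteqP; split=> [x Ix|_ [z Dz <-] y Iy]; last first.
  have Dzy : D (z * y).
    move: z Dz; rewrite -/(_ `<=` (fun z => D (z * y))).
    apply: ideal_mul_subset => [|u v Du Dv|u v Du Vv].
    - by rewrite mul0r; exact: (ideal0 fD).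
    - by rewrite mulrDl; exact: (idealD fD Du Dv).
    - by rewrite -mulrA; exact: (idealMr fD Du (Vv y Iy)).
  rewrite /trace_form mulrA divff // mul1r -[z * y]mulr1.
  exact/Dzy/OK1.
exists (a * x); last by rewrite mulKf.
have Dax y : I y -> D (a * x * y).
  by move=> Iy c Oc; have := Ix (y * c) (idealMr fI Iy Oc); rewrite /trace_form mulrA.
suff: ideal_mul I (ideal_inv I) `<=` (fun z => ideal_mul D (ideal_inv I) (a * x * z)).
  by rewrite (ideal_mul_inv galK) // => /(_ 1 (OK1 K)); rewrite mulr1.
apply: ideal_mul_subset => [|u v|u v Iu Vv].
- by rewrite mulr0; apply: ideal_mul0.
- by rewrite mulrDr; apply: ideal_mulD.
- by rewrite mulrA; apply: mem_ideal_mul => //; apply: Dax.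
Qed.

Lemma ideal_scaleA a b I : ideal_scale a (ideal_scale b I) = ideal_scale (b * a) I.
Proof.
apply/seteqP; split=> [_ [_ [x Ix <-] <-]|_ [x Ix <-]].
  by exists x; rewrite // mulrA [b * a]mulrC.
by exists (b * x); [exists x | rewrite mulrA [b * a]mulrC].
Qed.

(** In the group of fractional ideals, [b] times the dual of [Y] is [X - Y]. *)
Lemma scaled_dual_eq_iff (X Y : fideal galK) a b : a != 0 -> b != 0 ->
    X = ideal_scale (a^-1 * b) D :> set K ->
  (Y : set K) = ideal_scale b (dual_lattice Y a) <-> X = Y + Y.
Proof.
move=> nz_a nz_b DX; have fD := fractional_inverse_different.
have fY := fidealP Y; have fV := fractional_inv fY.
have -> : ideal_scale b (dual_lattice Y a) = X - Y.
  rewrite dual_latticeE // ideal_scaleA ideal_scale_mul; last exact: fractional_mul.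
  by rewrite ideal_mulA -ideal_scale_mul // fideal_setD DX.
split=> [/fideal_inj DY|->]; last by rewrite addrK.
by rewrite {2}DY addrC subrK.
Qed.

End Duality.

Theorem proposition4p2 (K : splittingFieldType rat)
    (K_galois : galois 1%VS {:K}) (K_real : totally_real K)
    (l : nat) (l_gt0 : (0 < l)%N) (l_sqfree : squarefree l) :
  (exists (I : set K) (alpha : K),
      ideal_lattice I alpha /\ arakelov_modular l I alpha)
  <->
  (exists alpha beta : K,
      [/\ alpha != 0, totally_positive alpha, beta != 0, l%:R = beta ^+ 2
        & forall P : set K, prime_ideal P ->
            (2 %| valuation P
                    (ideal_scale (alpha^-1 * beta) (inverse_different K)))%Z]).
Proof.
have fX (a b : K) : a != 0 -> b != 0 ->
    fractional_ideal (ideal_scale (a^-1 * b) (inverse_different K)).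
  move=> nz_a nz_b; apply: fractional_scale; first by rewrite mulf_neq0 ?invr_eq0.
  exact: fractional_inverse_different.
split=> [[I [a [[fI nz_a pos_a] [b [nz_b DI Dl]]]]]|[a [b [nz_a pos_a nz_b Dl evenX]]]].
- pose X := mk_fideal K_galois (fX a b nz_a nz_b); pose Y := mk_fideal K_galois fI.
  exists a, b; split=> //; apply: (even_valuationP X).2; exists Y.
  exact: (@scaled_dual_eq_iff _ _ X Y a b nz_a nz_b erefl).1 DI.
- pose X := mk_fideal K_galois (fX a b nz_a nz_b).
  have [Y DX] := (even_valuationP X).1 evenX.
  exists Y, a; split; first by split=> //; exact: fidealP.
  exists b; split=> //.
  exact: (@scaled_dual_eq_iff _ _ X Y a b nz_a nz_b erefl).2 DX.
Qed.
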